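(* Let $n,k,l$ be integers with $k\geq l\geq2$ and $n>k+l$. Let $G$ be a connected graph with vertex set $\{u_1,v_1,w_1,\ldots,w_{n-k-l}\}$ in which $u_1\sim v_1$ and $N_G(u_1)\setminus\{v_1\}=N_G(v_1)\setminus\{u_1\}$. For integers $a,b\geq1$ let $G_{a,b}(u_1,v_1)$ be the graph obtained from $G$ by attaching a path $u_1u_2\cdots u_a$ at $u_1$ (new vertices $u_2,\ldots,u_a$) and a path $v_1v_2\cdots v_b$ at $v_1$ (new vertices $v_2,\ldots,v_b$). Then $$\partial^L_1(G_{k+1,l-1}(u_1,v_1))\geq\partial^L_1(G_{k,l}(u_1,v_1)).$$ Moreover, if equality holds, then there exists a unit eigenvector of $\mathcal{L}(G_{k,l}(u_1,v_1))$ corresponding to $\partial^L_1(G_{k,l}(u_1,v_1))$ that takes the same value on all vertices $u_1,v_1,w_1,\ldots,w_{n-k-l}$ of $V(G)$.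
   Context: All graphs are finite, simple, undirected and connected; $d(u,v)$ is graph distance, $N_G(v)$ is the neighbourhood of $v$. The transmission of $v$ is $Tr(v)=\sum_u d(v,u)$; $\mathcal{L}(H)=Tr(H)-D(H)$ is the distance Laplacian matrix ($Tr(H)$ diagonal matrix of transmissions, $D(H)$ distance matrix), and $\partial^L_1(H)$ its largest eigenvalue. *)

(* Defs.v *)
From HB Require Import structures.
From mathcomp Require Import all_boot all_order all_algebra.
From mathcomp Require Import all_classical reals.

Set Implicit Arguments.
Unset Strict Implicit.
Unset Printing Implicit Defensive.

Import Order.TTheory GRing.Theory Num.Theory.

Local Open Scope ring_scope.

Definition simple_graph (V : finType) (e : rel V) : Prop :=
  symmetric e /\ irreflexive e.

Definition connected_graph (V : finType) (e : rel V) : Prop :=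
  forall x y : V, connect e x y.

Definition neighbours (V : finType) (e : rel V) (x : V) : {set V} :=
  finset (e x).

Definition walk_of_length (V : finType) (e : rel V) (x y : V) (m : nat) : bool :=
  [exists p : m.-tuple V, path e x p && (last x p == y)].

(* The least length of a walk from x to y. A shortest walk has fewer than #|V|
   edges, so the range searched suffices; the value is #|V| exactly when y is
   not reachable from x, which never happens in a connected graph. *)
Definition gdist (V : finType) (e : rel V) (x y : V) : nat :=
  find (walk_of_length e x y) (iota 0 #|V|).

Definition transmission (V : finType) (e : rel V) (x : V) : nat :=
  (\sum_(y : V) gdist e x y)%N.

(* The matrices of a graph on V are indexed by 'I_#|V|, through enum_val. *)
Definition dist_mx (R : realType) (V : finType) (e : rel V) : 'M[R]_#|V| :=
  \matrix_(i, j) (gdist e (enum_val i) (enum_val j))%:R.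

Definition transmission_mx (R : realType) (V : finType) (e : rel V) :
    'M[R]_#|V| :=
  diag_mx (\row_i (transmission e (enum_val i))%:R).

Definition dist_laplacian (R : realType) (V : finType) (e : rel V) :
    'M[R]_#|V| :=
  transmission_mx R e - dist_mx R e.

(* The set of eigenvalues of A is finite, and nonempty when A is a real
   symmetric matrix of positive order, so that the supremum is then a maximum. *)
Definition largest_eigenvalue (R : realType) (n : nat) (A : 'M[R]_n) : R :=
  sup [set a : R | eigenvalue A a]%classic.

Definition dL1 (R : realType) (V : finType) (e : rel V) : R :=
  largest_eigenvalue (dist_laplacian R e).

(* Attach at x a path with m new vertices: inr i, for i = 0, ..., m - 1, is the
   new vertex at distance i + 1 from x along the path. *)
Definition attach_path (V : finType) (e : rel V) (x : V) (m : nat) :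
    rel (V + 'I_m)%type :=
  fun p q => match p, q with
  | inl y, inl z => e y z
  | inl y, inr j => (y == x) && (j == 0 :> nat)
  | inr i, inl z => (z == x) && (i == 0 :> nat)
  | inr i, inr j => (i.+1 == j :> nat) || (j.+1 == i :> nat)
  end.
Arguments attach_path {V} e x m.

(* The graph G_{a,b}(u, v), for a, b >= 1: the paths u_1 ... u_a and
   v_1 ... v_b include u = u_1 and v = v_1, hence have a - 1 and b - 1 new
   vertices; a vertex w of G becomes inl (inl w). *)
Definition two_paths (V : finType) (e : rel V) (u v : V) (a b : nat) :
    rel ((V + 'I_a.-1) + 'I_b.-1)%type :=
  attach_path (attach_path e u a.-1) (inl v) b.-1.
Arguments two_paths {V} e u v a b.

(* Main.v *)
(* The largest eigenvalue of the distance Laplacian is the maximum over unit f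
   of the sum of d(p, q) (f p - f q)^2 over unordered pairs. Take a maximiser f
   for G_{k,l} and number the long path u_k ... u_1 v_1 ... v_l from 0. Since u_1
   and v_1 are at the same distance from every other vertex w of G, moving one
   vertex from one end of the path to the other only changes the distances
   between path vertices and the w's. Transport f to G_{k+1,l-1} in two ways:
   keeping the order of the path, or reversing it. The changes of the form are
   combinations of the terms (f w - f p)^2 with coefficients of both signs, but
   the first change taken k + 1 - l times plus the second has only nonnegative
   coefficients, and those at p = u_1 and p = v_1 are positive. Hence one of the
   two does not decrease the form; in case of equality f w = f u_1 = f v_1 for
   all w. *)
Require Import Defs.
From HB Require Import structures.
From mathcomp Require Import all_boot all_order all_algebra.
From mathcomp Require Import all_classical reals.
From mathcomp Require Import complex zify ring lra.

Set Implicit Arguments.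
Unset Strict Implicit.
Unset Printing Implicit Defensive.

Import Order.TTheory GRing.Theory Num.Theory.
Local Open Scope ring_scope.

(** * Rayleigh bound for real symmetric matrices *)

Local Open Scope sesquilinear_scope.

(** [z] holds the coordinates of [v] in the orthonormal eigenbasis formed by the rows of
    [spectralmx A]; in them both Hermitian forms are diagonal. *)
Lemma normalmx_form (C : numClosedFieldType) (n : nat) (A : 'M[C]_n)
    (v : 'rV[C]_n) (z := v *m (spectralmx A)^t*) :
  A \is normalmx ->
  (v *m A *m v^t*) 0 0 = \sum_i spectral_diag A 0 i * `|z 0 i| ^+ 2
  /\ (v *m v^t*) 0 0 = \sum_i `|z 0 i| ^+ 2.
Proof.
move=> /orthomx_spectralP A_eq.
have P_unitary := spectral_unitarymx A.
have zE : z^t* = spectralmx A *m v^t*.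
  by rewrite /z trmx_mul map_mxM trmxCK.
split.
  rewrite {1}A_eq invmx_unitary // !mulmxA -/z -mulmxA -zE mxE.
  by apply: eq_bigr => i _; rewrite mul_mx_diag !mxE normCK mulrAC mulrC.
have -> : v *m v^t* = z *m z^t*.
  by rewrite zE /z mulmxA mulmxKtV.
by rewrite mxE; apply: eq_bigr => i _; rewrite !mxE normCK.
Qed.

(** The complexification of [A] is Hermitian, so its spectral values are reals [s i], each an
    eigenvalue of [A]. The greatest one bounds the form by diagonalisation, hence bounds every
    eigenvalue, so the supremum is attained there. *)
Lemma symmetric_spectral (R : realType) (n : nat) (A : 'M[R]_n) :
  (0 < n)%N -> A^T = A ->
  eigenvalue A (largest_eigenvalue A) /\
  forall x : 'rV[R]_n,
    (x *m A *m x^T) 0 0 <= largest_eigenvalue A * (x *m x^T) 0 0.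
Proof.
case: n A => [//|n] A _ symA; pose toC := real_complex R.
pose Ac := map_mx toC A.
have herA : Ac \is hermsymmx.
  apply: realsym_hermsym.
    by apply/is_hermitianmxP; rewrite expr0 scale1r map_mx_id // map_trmx symA.
  by apply/mxOverP => i j; rewrite mxE; apply/complex_realP; eexists.
have norA := hermitian_normalmx herA.
have /mxOverP sp_real := hermitian_spectral_diag_real herA.
pose s i := complex.Re (spectral_diag Ac 0 i).
have sE i : spectral_diag Ac 0 i = toC (s i) by rewrite /toC RRe_real.
have s_eigen i : eigenvalue A (s i).
  rewrite -(eigenvalue_map toC); apply/eigenvalueP.
  have P_unit := spectral_unit Ac.
  exists (row i (spectralmx Ac)).
    have PA : spectralmx Ac *m Ac = diag_mx (spectral_diag Ac) *m spectralmx Ac.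
      rewrite [X in _ *m X = _](orthomx_spectralP norA).
      by rewrite !mulmxA mulmxV // mul1mx.
    rewrite -row_mul PA.
    by apply/rowP => j; rewrite mul_diag_mx !mxE sE.
  apply/eqP => /(congr1 (mulmx^~ (invmx (spectralmx Ac)))).
  rewrite mul0mx -row_mul mulmxV // => /rowP/(_ i).
  by rewrite !mxE eqxx => /eqP; rewrite oner_eq0.
have [i0 _ i0_max] : extremum_spec >=%R xpredT s [arg max_(i > ord0) s i]%O.
  exact: arg_maxP.
have bound (x : 'rV[R]_n.+1) :
    (x *m A *m x^T) 0 0 <= s i0 * (x *m x^T) 0 0.
  suff: toC ((x *m A *m x^T) 0 0) <= toC (s i0) * toC ((x *m x^T) 0 0).
    by rewrite -rmorphM lecR.
  have xE : (map_mx toC x)^t* = map_mx toC x^T.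
    by apply/matrixP => i j; rewrite !mxE; apply: conjc_real.
  have [] := normalmx_form (map_mx toC x) norA.
  have toCE (B : 'M[R]_1) : map_mx toC B 0 0 = toC (B 0 0) by rewrite mxE.
  rewrite xE -!map_mxM !toCE.
  move=> -> ->.
  rewrite mulr_sumr; apply: ler_sum => i _; rewrite sE.
  by apply: ler_wpM2r; rewrite ?exprn_ge0 // lecR; apply: i0_max.
have bound_eigen a : eigenvalue A a -> a <= s i0.
  move=> /eigenvalueP [v vA v_neq0].
  have v_gt0 : 0 < (v *m v^T) 0 0.
    rewrite lt_def mxE sumr_ge0 ?andbT; last first.
      by move=> i _; rewrite mxE -expr2 sqr_ge0.
    rewrite psumr_neq0 => [|i _]; last by rewrite mxE -expr2 sqr_ge0.
    have /rV0Pn [i vi] := v_neq0; apply/hasP; exists i.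
      by rewrite mem_index_enum.
    by rewrite mxE -expr2 lt_def sqrf_eq0 vi sqr_ge0.
  have := bound v; rewrite vA -scalemxAl [X in X <= _]mxE.
  by rewrite ler_pM2r.
suff -> : largest_eigenvalue A = s i0 by [].
apply/eqP; rewrite eq_le; apply/andP; split.
  by apply: ge_sup => //; exists (s i0); apply: s_eigen.
by apply: ub_le_sup; [exists (s i0)|apply: s_eigen].
Qed.

Local Close Scope sesquilinear_scope.

(** * Walks and graph distance *)

Lemma walk_of_lengthP (V : finType) (e : rel V) (x y : V) (m : nat) :
  reflect (exists p, [/\ path e x p, last x p = y & size p = m])
          (walk_of_length e x y m).
Proof.
apply: (iffP existsP) => [[p /andP[ep /eqP <-]]|[p [ep <- <-]]].
  by exists p; rewrite size_tuple.
by exists (in_tuple p); rewrite ep eqxx.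
Qed.

Lemma gdist_le_walk (V : finType) (e : rel V) (x y : V) (m : nat) :
  walk_of_length e x y m -> (gdist e x y <= m)%N.
Proof.
move=> walk_m; rewrite leqNgt; apply/negP => m_lt.
have := before_find 0%N m_lt; rewrite nth_iota ?add0n ?walk_m //.
by apply: leq_trans m_lt _; rewrite (leq_trans (find_size _ _)) ?size_iota.
Qed.

(** Shortening a walk to one without repeated vertices brings its length below [#|V|], inside the
    range that [gdist] searches. *)
Lemma walk_gdist (V : finType) (e : rel V) (x y : V) :
  connect e x y -> walk_of_length e x y (gdist e x y).
Proof.
move=> /connectP[p0 /shortenP[p ep uniq_p _] ->].
have has_walk : has (walk_of_length e x (last x p)) (iota 0 #|V|).
  apply/hasP; exists (size p); last by apply/walk_of_lengthP; exists p.
  rewrite mem_iota add0n; have := card_uniqP uniq_p => /= <-.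
  exact: max_card.
have := nth_find 0%N has_walk; rewrite nth_iota ?add0n //.
by rewrite -[X in (_ < X)%N](size_iota 0) -has_find.
Qed.

(** A certificate for computing distances: following predecessors back to [x] builds a walk of
    length [D y], and since [D] grows by at most one along an edge, no walk is shorter. *)
Lemma gdist_eq (V : finType) (e : rel V) (x : V) (D : V -> nat) :
  D x = 0%N -> (forall y z, e y z -> (D z <= (D y).+1)%N) ->
  (forall y, y != x -> exists2 z, e z y & D y = (D z).+1) ->
  forall y, connect e x y /\ gdist e x y = D y.
Proof.
move=> Dx D_edge D_pred y.
have walk_D m z : D z = m -> walk_of_length e x z m.
  elim: m z => [|m IHm] z Dz.
    apply/walk_of_lengthP; exists [::]; split => //=.
    by apply/esym/eqP; apply: contra_eqT Dz => /D_pred [t _ ->].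
  have /D_pred [t tz] : z != x by apply: contra_eq_neq Dz => ->; rewrite Dx.
  rewrite Dz => -[/esym /IHm /walk_of_lengthP[p [ep lp <-]]].
  apply/walk_of_lengthP; exists (rcons p z).
  by rewrite rcons_path last_rcons size_rcons ep lp.
have D_walk p z : path e z p -> (D (last z p) <= D z + size p)%N.
  elim: p z => [|t p IHp] z /=; first by rewrite addn0.
  by move=> /andP[/D_edge zt /IHp]; lia.
have walk_y := walk_D _ _ (erefl (D y)).
have [p0 [ep0 lp0 _]] := walk_of_lengthP _ _ _ _ walk_y.
have xy : connect e x y by apply/connectP; exists p0.
split=> //; apply/eqP; rewrite eqn_leq gdist_le_walk //=.
move: (walk_gdist xy) => /walk_of_lengthP [p [/D_walk D_le lp <-]].
by rewrite lp Dx in D_le.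
Qed.

(** * Distances in a connected graph, twins, and attaching a path *)

Section ConnectedDistance.
Variables (V : finType) (e : rel V).
Hypothesis e_conn : connected_graph e.

Lemma gdistxx x : gdist e x x = 0%N.
Proof.
apply/eqP; rewrite -leqn0 gdist_le_walk //.
by apply/walk_of_lengthP; exists [::].
Qed.

Lemma gdist_eq0 x y : gdist e x y = 0%N -> x = y.
Proof.
move=> dxy; have := walk_gdist (e_conn x y); rewrite dxy.
by case/walk_of_lengthP => -[|z p] [//= _].
Qed.

Lemma gdist_edge x y z : e y z -> (gdist e x z <= (gdist e x y).+1)%N.
Proof.
move=> yz; have /walk_of_lengthP[p [ep lp sp]] := walk_gdist (e_conn x y).
apply/gdist_le_walk/walk_of_lengthP; exists (rcons p z).
by rewrite rcons_path last_rcons size_rcons ep lp sp.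
Qed.

Lemma gdist_pred x y :
  y != x -> exists2 z, e z y & gdist e x y = (gdist e x z).+1.
Proof.
move=> yx; have /walk_of_lengthP[p [ep lp sp]] := walk_gdist (e_conn x y).
case/lastP: p ep lp sp => [_ /= xy|p t].
  by rewrite xy eqxx in yx.
rewrite rcons_path last_rcons size_rcons => /andP[ep pt] tE sp; subst t.
exists (last x p) => //; apply/eqP; rewrite eqn_leq gdist_edge // -sp ltnS.
by apply/gdist_le_walk/walk_of_lengthP; exists p.
Qed.

Lemma gdistC x y : symmetric e -> gdist e x y = gdist e y x.
Proof.
move=> e_sym; suff le a b : (gdist e a b <= gdist e b a)%N.
  by apply/eqP; rewrite eqn_leq !le.
have /walk_of_lengthP[p [ep lp <-]] := walk_gdist (e_conn b a).
apply/gdist_le_walk/walk_of_lengthP; exists (rev (belast b p)); split.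
- by rewrite -lp rev_path (eq_path (e' := e)) // => s t; rewrite e_sym.
- by case: p lp {ep} => [|t p] //= _; rewrite rev_cons last_rcons.
- by rewrite size_rev size_belast.
Qed.

(* The last edge of a shortest walk from w to u either comes from v or can be
   redirected to v. *)
Lemma gdist_twins u v w : symmetric e ->
  neighbours e u :\ v = neighbours e v :\ u ->
  w != u -> w != v -> gdist e w u = gdist e w v.
Proof.
move=> e_sym uv wu wv.
suff le a b : neighbours e a :\ b = neighbours e b :\ a -> w != a ->
    (gdist e w b <= gdist e w a)%N.
  by apply/eqP; rewrite eqn_leq !le.
move=> ab wa; have [z za ->] : exists2 z, e z a &
    gdist e w a = (gdist e w z).+1 by apply: gdist_pred; rewrite eq_sym.
have [->|zb] := eqVneq z b; first exact: leqnSn.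
apply: gdist_edge; have /setP/(_ z) := ab.
by rewrite !inE zb e_sym za /= e_sym => /esym /andP[].
Qed.

(** With truncated subtraction, [(i - j) + (j - i)] is the absolute difference of [i] and [j]. *)
Definition attach_dist (x : V) (m : nat) (p q : V + 'I_m) : nat :=
  match p, q with
  | inl y, inl z => gdist e y z
  | inl y, inr j => gdist e y x + j.+1
  | inr i, inl z => gdist e x z + i.+1
  | inr i, inr j => (i - j) + (j - i)
  end.

Lemma gdist_attach_path (x : V) (m : nat) (p q : V + 'I_m) :
  connect (attach_path e x m) p q /\
  gdist (attach_path e x m) p q = attach_dist x p q.
Proof.
move: q; apply: gdist_eq.
- by case: p => [y|i] /=; rewrite ?gdistxx ?subnn.
- case: p => [y|i] [z|j] [t|j'] /=.
  + exact: gdist_edge.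
  + by case/andP => /eqP -> /eqP ->; lia.
  + by case/andP => /eqP -> /eqP ->; lia.
  + lia.
  + by move=> /(gdist_edge x); lia.
  + by case/andP => /eqP -> /eqP ->; rewrite gdistxx; lia.
  + by case/andP => /eqP -> /eqP ->; rewrite gdistxx; lia.
  + lia.
(* The predecessor of the target: inside the old graph it is the one given by [gdist_pred], except
   that [x] reached from the path has the first new vertex before it; on the path it is the
   neighbour on the side of the source. *)
- case: p => [y|i] [z|j] /=.
  + move=> zy; have [|t tz ->] := @gdist_pred y z; last by exists (inl t).
    by apply: contra_neq zy => ->.
  + move=> _; case: j => -[|j] j_lt /=.
      by exists (inl x); rewrite /= ?eqxx //; lia.
    by exists (inr (Ordinal (ltnW j_lt))); rewrite /=; lia.
  + move=> _; have [->|zx] := eqVneq z x.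
      have m_gt0 : (0 < m)%N by case: i => i; lia.
      by exists (inr (Ordinal m_gt0)); rewrite /= ?eqxx // gdistxx; lia.
    by have [t tz ->] := gdist_pred zx; exists (inl t).
  + move=> ji; have {ji} : (j != i :> nat)%N.
      by apply: contra_neq ji => /val_inj ->.
    rewrite neq_ltn => /orP[ji|ij].
      have j_lt : (j.+1 < m)%N by case: i ji => i /=; lia.
      by exists (inr (Ordinal j_lt)); rewrite /=; lia.
    have j_lt : (j.-1 < m)%N by case: j ij => j /=; lia.
    by exists (inr (Ordinal j_lt)); rewrite /=; lia.
Qed.

End ConnectedDistance.

(** * The quadratic form of the distance Laplacian *)

Definition dist_form (R : realType) (S : finType) (D : S -> S -> nat)
    (f : S -> R) : R :=
  \sum_p \sum_q (D p q)%:R * (f p - f q) ^+ 2.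

Section DistanceLaplacian.
Variables (R : realType) (V : finType) (e : rel V).
Hypotheses (e_sym : symmetric e) (e_conn : connected_graph e).

Lemma tr_dist_laplacian : (dist_laplacian R e)^T = dist_laplacian R e.
Proof.
rewrite /dist_laplacian linearB /= tr_diag_mx; congr (_ - _).
by apply/matrixP => i j; rewrite !mxE gdistC.
Qed.

(** [dist_form] runs over ordered pairs, whence the factor 2. The form is written once with [i] and
    once with [j] as the outer index; adding the two copies completes the square. *)
Lemma dist_laplacian_form (x : 'rV[R]_#|V|) :
  2 * (x *m dist_laplacian R e *m x^T) 0 0 =
  dist_form (gdist e) (fun p => x 0 (enum_rank p)).
Proof.
pose d (i j : 'I_#|V|) : R := (gdist e (enum_val i) (enum_val j))%:R.
have dC i j : d i j = d j i by rewrite /d gdistC.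
have formE : (x *m dist_laplacian R e *m x^T) 0 0 =
    \sum_i \sum_j d i j * (x 0 i - x 0 j) * x 0 i.
  rewrite mxE; apply: eq_bigr => i _; rewrite !mxE -mulr_suml; congr (_ * _).
  rewrite (eq_bigr (fun j =>
      x 0 j * (transmission_mx R e j i) - x 0 j * d j i)).
    rewrite sumrB (bigD1 i) //= big1 => [|j ji]; last first.
      by rewrite !mxE (negbTE ji) mulr0.
    rewrite addr0 !mxE eqxx mulr1n natr_sum mulr_sumr.
    rewrite (reindex _ (onW_bij _ (enum_val_bij V))) /= -sumrB.
    by apply: eq_bigr => j _; rewrite dC mulrBr ![_ * d i j]mulrC.
  by move=> j _; rewrite !mxE mulrBr.
have form_swap : (x *m dist_laplacian R e *m x^T) 0 0 =
    \sum_i \sum_j d i j * (x 0 j - x 0 i) * x 0 j.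
  rewrite formE exchange_big; apply: eq_bigr => i _; apply: eq_bigr => j _.
  by rewrite dC.
rewrite mulr_natl mulr2n {1}formE form_swap -big_split /=.
rewrite /dist_form (reindex _ (onW_bij _ (enum_val_bij V))) /=.
apply: eq_bigr => i _; rewrite -big_split /=.
rewrite (reindex _ (onW_bij _ (enum_val_bij V))) /=.
by apply: eq_bigr => j _; rewrite !enum_valK -/(d i j); ring.
Qed.

Lemma dist_form_le_dL1 (f : V -> R) :
  dist_form (gdist e) f <= 2 * dL1 R e * \sum_p f p ^+ 2.
Proof.
have [V0|V_gt0] := posnP #|V|.
  by rewrite /dist_form !big1 ?mulr0 // => p; have := fintype0 p V0.
have [_ le_dL1] := symmetric_spectral V_gt0 tr_dist_laplacian.
pose x := \row_(i < #|V|) f (enum_val i).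
have formE : dist_form (gdist e) f = 2 * (x *m dist_laplacian R e *m x^T) 0 0.
  rewrite dist_laplacian_form.
  by apply: eq_bigr => p _; apply: eq_bigr => q _; rewrite !mxE !enum_rankK.
have -> : \sum_p f p ^+ 2 = (x *m x^T) 0 0.
  rewrite mxE (reindex _ (onW_bij _ (enum_val_bij V))) /=.
  by apply: eq_bigr => i _; rewrite !mxE expr2.
by rewrite formE -mulrA ler_pM2l // le_dL1.
Qed.

Lemma dL1_eigenvector : (0 < #|V|)%N ->
  exists2 f : V -> R,
    let x := \col_i f (enum_val i) in
    dist_laplacian R e *m x = dL1 R e *: x &
    \sum_p f p ^+ 2 = 1 /\ dist_form (gdist e) f = 2 * dL1 R e.
Proof.
move=> V_gt0; have [/eigenvalueP[v vL v_neq0] _] :=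
  symmetric_spectral V_gt0 tr_dist_laplacian.
rewrite -/(dL1 R e) in vL.
pose N := \sum_i v 0 i ^+ 2.
have N_gt0 : 0 < N.
  rewrite lt_def sumr_ge0 ?andbT => [|i _]; last exact: sqr_ge0.
  rewrite psumr_neq0 => [|i _]; last exact: sqr_ge0.
  have /rV0Pn [i vi] := v_neq0; apply/hasP; exists i.
    by rewrite mem_index_enum.
  by rewrite lt_def sqrf_eq0 vi sqr_ge0.
pose y := (Num.sqrt N)^-1 *: v.
have yL : y *m dist_laplacian R e = dL1 R e *: y.
  by rewrite -scalemxAl vL !scalerA mulrC.
have y_unit : \sum_i y 0 i ^+ 2 = 1.
  under eq_bigr do rewrite mxE exprMn exprVn sqr_sqrtr ?ltW //.
  by rewrite -mulr_sumr mulVf ?gt_eqF.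
have yE : y^T = \col_i y 0 (enum_rank (enum_val i)).
  by apply/colP => i; rewrite [LHS]mxE [RHS]mxE enum_valK.
exists (fun p => y 0 (enum_rank p)) => /=.
  (* [eigenvalue] provides a row eigenvector; symmetry of the matrix turns it into a column one. *)
  by rewrite -yE -[LHS]trmxK trmx_mul trmxK tr_dist_laplacian yL linearZ.
have sumE : \sum_p y 0 (enum_rank p) ^+ 2 = 1.
  by rewrite -[RHS]y_unit (reindex _ (onW_bij _ (enum_rank_bij V))).
split=> //; rewrite -dist_laplacian_form yL -scalemxAl mxE mxE.
rewrite -[RHS]mulr1 -[X in _ = _ * X]y_unit mulrA; congr (_ * _).
by apply: eq_bigr => i _; rewrite [y^T i 0]mxE expr2.
Qed.

End DistanceLaplacian.

Lemma dist_form_bij (R : realType) (T S : finType) (c : T -> S)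
    (D : S -> S -> nat) (f : S -> R) :
  bijective c ->
  dist_form D f = dist_form (fun p q => D (c p) (c q)) (f \o c).
Proof.
move=> c_bij; rewrite /dist_form (reindex _ (onW_bij _ c_bij)).
by apply: eq_bigr => p _; rewrite (reindex _ (onW_bij _ c_bij)).
Qed.

(** * Distances in [two_paths], in coordinates along the long path *)

Lemma attach_path_sym (V : finType) (e : rel V) (x : V) (m : nat) :
  symmetric e -> symmetric (attach_path e x m).
Proof. by move=> e_sym [y|i] [z|j] //=; rewrite orbC. Qed.

Section TwoPaths.
Variables (V : finType) (e : rel V) (u v : V).
Hypotheses (e_sym : symmetric e) (e_conn : connected_graph e) (uv : e u v).
Hypotheses (uv_neq : u != v).
Hypothesis uv_twins : neighbours e u :\ v = neighbours e v :\ u.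

Definition core := {w : V | (w != u) && (w != v)}.

(** For [a >= 1], the distance along the path from position [p] to the nearer of the positions
    [a - 1] and [a] of [u] and [v]; at most one summand is nonzero. *)
Definition spine_depth (a p : nat) : nat := (a.-1 - p) + (p - a).

(* The path u_a ... u_1 v_1 ... v_b is numbered 0, ..., a + b - 1, so that
   u_1 = u and v_1 = v are numbered a - 1 and a. *)
Definition spine_dist (N a : nat) (s t : core + 'I_N.+1) : nat :=
  match s, t with
  | inl w, inl w' => gdist e (val w) (val w')
  | inl w, inr p | inr p, inl w => gdist e u (val w) + spine_depth a p
  | inr p, inr q => (p - q) + (q - p)
  end.

(** The target type depends on [a] and [b] only through [N], so two graphs with the same [a + b]
    share their coordinates. The new vertex [i] at [u] is $u_{i+2}$, numbered [a - 2 - i]; the new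
    vertex [j] at [v] is $v_{j+2}$, numbered [a + 1 + j]. *)
Definition spine_coord (N a b : nat) (s : (V + 'I_a.-1) + 'I_b.-1) :
    core + 'I_N.+1 :=
  match s with
  | inl (inl w) =>
      if insub w is Some w' then inl w'
      else inr (inord (if w == u then a.-1 else a))
  | inl (inr i) => inr (inord (a.-2 - i))
  | inr j => inr (inord (a.+1 + j))
  end.

Variant core_spec (N a b : nat) (w : V) :
    core + 'I_N.+1 -> Type :=
  | CoreU of w = u : core_spec a b w (inr (inord a.-1))
  | CoreV of w = v : core_spec a b w (inr (inord a))
  | CoreW (w' : core) of w = val w' & w != u & w != v :
      core_spec a b w (inl w').

Lemma coreP (N a b : nat) (w : V) :
  core_spec a b w (@spine_coord N a b (inl (inl w))).
Proof.
rewrite /=; case: insubP => [w' /andP[wu wv] /esym wE|].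
  by apply: CoreW.
rewrite negb_and !negbK; have [wu _|_ /= /eqP wv] := eqVneq w u.
  exact: CoreU.
exact: CoreV.
Qed.

Lemma two_paths_sym a b : symmetric (two_paths e u v a b).
Proof. exact/attach_path_sym/attach_path_sym. Qed.

Lemma two_paths_connected a b : connected_graph (two_paths e u v a b).
Proof.
move=> s t; apply: (gdist_attach_path _ _ _ _).1 => s' t'.
exact: (gdist_attach_path _ _ _ _).1.
Qed.

(** Two uses of [gdist_attach_path] reduce everything to distances in the original graph. There [u]
    and [v] are adjacent and, being twins, equidistant from each core vertex, so such a vertex
    reaches the spine equally well through either. *)
Lemma gdist_two_paths (N a b : nat) (s t : (V + 'I_a.-1) + 'I_b.-1) :
  (0 < a)%N -> (0 < b)%N -> (a + b)%N = N.+1 ->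
  gdist (two_paths e u v a b) s t =
  spine_dist a (spine_coord N s) (spine_coord N t).
Proof.
move=> a_gt0 b_gt0 abN.
have duv : gdist e u v = 1%N.
  apply/eqP; rewrite eqn_leq.
  have := gdist_edge e_conn u uv; rewrite gdistxx // => -> /=.
  rewrite lt0n; apply: contra_neq uv_neq; exact: gdist_eq0.
have dvu : gdist e v u = 1%N by rewrite gdistC.
have dwu (w : core) : gdist e (val w) u = gdist e u (val w) by rewrite gdistC.
have dwv (w : core) : gdist e (val w) v = gdist e u (val w).
  have /andP[wu wv] := valP w.
  by rewrite -(gdist_twins e_conn e_sym uv_twins wu wv) gdistC.
have dvw (w : core) : gdist e v (val w) = gdist e u (val w).
  by rewrite gdistC // dwv.
have e1_conn : connected_graph (attach_path e u a.-1).
  by move=> p q; apply: (gdist_attach_path _ _ _ _).1.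
rewrite (gdist_attach_path _ _ _ _).2 //.
rewrite /attach_dist.
have d1 p q := (@gdist_attach_path _ _ e_conn u a.-1 p q).2.
have i_lt (m : nat) (i : 'I_m) : (i < m)%N by [].
case: s t => [[w|i]|j] [[w2|i2]|j2]; rewrite ?d1 /attach_dist.
all: try case: (coreP N a b w) => [wE|wE|w' wE _ _]; try rewrite wE.
all: try case: (coreP N a b w2) => [w2E|w2E|w2' w2E _ _]; try rewrite w2E.
all: rewrite /spine_coord /spine_dist /spine_depth ?gdistxx //.
all: rewrite ?duv ?dvu ?dwu ?dwv ?dvw ?inordK //.
all: try have := i_lt _ i; try have := i_lt _ i2.
all: try have := i_lt _ j; try have := i_lt _ j2.
all: lia.
Qed.

(** Vertices with equal coordinates are at distance 0 by [gdist_two_paths], hence equal; bijectivity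
    then follows by counting. *)
Lemma spine_coord_bij (N a b : nat) :
  (0 < a)%N -> (0 < b)%N -> (a + b)%N = N.+1 -> bijective (@spine_coord N a b).
Proof.
move=> a_gt0 b_gt0 abN; apply: inj_card_bij => [s t st|].
  have := gdist_two_paths s t a_gt0 b_gt0 abN; rewrite st.
  have -> : spine_dist a (spine_coord N t) (spine_coord N t) = 0%N.
    by case: (spine_coord N t) => [w|p] /=; rewrite ?gdistxx ?subnn.
  by move/gdist_eq0; apply; apply: two_paths_connected.
have core_card : (#|{: core}| + 2 = #|V|)%N.
  rewrite card_sig -(cardsC [set u; v]) cards2 uv_neq addnC; congr (_ + _)%N.
  by apply: eq_card => w; rewrite !inE negb_or.
by rewrite !card_sum !card_ord -core_card -!addnA leq_add2l; lia.
Qed.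

End TwoPaths.

(** * Comparison of the forms for [k] and [k.+1] *)

Section SpineForm.
Variables (R : realType) (V : finType) (e : rel V) (u v : V).

Definition flip_spine (N : nat) (f : core u v + 'I_N.+1 -> R)
    (s : core u v + 'I_N.+1) : R :=
  match s with inl w => f (inl w) | inr p => f (inr (rev_ord p)) end.

(** The pairs inside the core and inside the spine, whose distances do not depend on [a]. *)
Definition core_form (N : nat) (f : core u v + 'I_N.+1 -> R) : R :=
  \sum_w \sum_w' (gdist e (val w) (val w'))%:R * (f (inl w) - f (inl w')) ^+ 2
  + \sum_(p < N.+1) \sum_(q < N.+1)
      ((p - q) + (q - p))%:R * (f (inr p) - f (inr q)) ^+ 2.

(** Each pair of a core and a spine vertex is counted once here, but twice in [dist_form]. The free
    coefficient [c] also allows the indicator of the positions of [u] and [v]. *)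
Definition cross_form (N : nat) (c : core u v -> 'I_N.+1 -> nat)
    (f : core u v + 'I_N.+1 -> R) : R :=
  \sum_w \sum_p (c w p)%:R * (f (inl w) - f (inr p)) ^+ 2.

Lemma dist_form_spine (N a : nat) (f : core u v + 'I_N.+1 -> R) :
  dist_form (spine_dist e a) f =
  core_form f
  + 2 * cross_form (fun w p => gdist e u (val w) + spine_depth a p)%N f.
Proof.
rewrite /dist_form /core_form big_sumType /=.
under eq_bigr do rewrite big_sumType /=.
under [in X in _ + X]eq_bigr do rewrite big_sumType /=.
rewrite !big_split /= [X in _ + _ + (X + _)]exchange_big /=.
rewrite [X in _ + _ + (X + _)](_ : _ =
  cross_form (fun w p => gdist e u (val w) + spine_depth a p)%N f).
  rewrite /cross_form; ring.
by apply: eq_bigr => w _; apply: eq_bigr => p _; congr (_ * _); ring.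
Qed.

Lemma core_form_flip (N : nat) (f : core u v + 'I_N.+1 -> R) :
  core_form (flip_spine f) = core_form f.
Proof.
congr (_ + _); rewrite [RHS](reindex_inj rev_ord_inj) /=.
apply: eq_bigr => p _; rewrite [RHS](reindex_inj rev_ord_inj) /=.
apply: eq_bigr => q _; congr (_%:R * _).
by have := ltn_ord p; have := ltn_ord q; lia.
Qed.

Lemma cross_form_flip (N : nat) (c : core u v -> 'I_N.+1 -> nat)
    (f : core u v + 'I_N.+1 -> R) :
  cross_form c (flip_spine f) = cross_form (fun w p => c w (rev_ord p)) f.
Proof.
apply: eq_bigr => w _; rewrite (reindex_inj rev_ord_inj) /=.
by apply: eq_bigr => p _; rewrite rev_ordK.
Qed.

(** Passing from [k] to [k.+1] raises the depth by 1 for [p < k], keeps it 0 at [p = k], and lowers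
    it by 1 beyond. The weight [k.+1 - l] is exact: both sides agree for [p < l - 1] and for
    [p > k], while at [k - 1] and [k] there is room for the extra 1. *)
Lemma spine_depth_shift (k l p : nat) :
  (0 < l)%N -> (l <= k)%N -> (p < k + l)%N ->
  ((k.+1 - l).+1 * spine_depth k p + ((p == k.-1) || (p == k)) <=
   (k.+1 - l) * spine_depth k.+1 p + spine_depth k.+1 (k + l - p.+1))%N.
Proof.
move=> l_gt0 lk p_lt; rewrite /spine_depth.
have [p_lek|p_gtk] := leqP p k.
  have [->|p_neqk] := eqVneq p k; first by lia.
  have -> : (k.+1.-1 - p + (p - k.+1) = (k.-1 - p + (p - k)).+1)%N by lia.
  by lia.
have -> : (k.-1 - p + (p - k) = (k.+1.-1 - p + (p - k.+1)).+1)%N by lia.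
by lia.
Qed.

(* Averaging the comparison of the shifted labelling (weight k + 1 - l) with
   that of the shifted and reversed one cancels every negative term. *)
Lemma spine_form_shift (N k l : nat) (f : core u v + 'I_N.+1 -> R) :
  (0 < l)%N -> (l <= k)%N -> (k + l)%N = N.+1 ->
  (k.+1 - l).+1%:R * dist_form (spine_dist e k) f
  + 2 * cross_form (fun _ p => (p == k.-1 :> nat) || (p == k :> nat)) f <=
  (k.+1 - l)%:R * dist_form (spine_dist e k.+1) f
  + dist_form (spine_dist e k.+1) (flip_spine f).
Proof.
move=> l_gt0 lk klN; rewrite !dist_form_spine core_form_flip cross_form_flip.
set t := (k.+1 - l)%N.
pose d a (w : core u v) (p : 'I_N.+1) :=
  (gdist e u (val w) + spine_depth a p)%N.
(* Each side carries [t.+1] copies of [core_form f], which cancel; the cross forms are compared term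
   by term. *)
have : t.+1%:R * cross_form (d k) f
    + cross_form (fun _ p => (p == k.-1 :> nat) || (p == k :> nat)) f
    <= t%:R * cross_form (d k.+1) f
       + cross_form (fun w p => d k.+1 w (rev_ord p)) f.
  rewrite /cross_form !mulr_sumr -!big_split; apply: ler_sum => w _ /=.
  rewrite !mulr_sumr -!big_split; apply: ler_sum => p _ /=.
  have := sqr_ge0 (f (inl w) - f (inr p)); move: (_ ^+ 2) => F F_ge0.
  rewrite !mulrA -!mulrDl ler_wpM2r // -!natrM -!natrD ler_nat /d /=.
  have := spine_depth_shift l_gt0 lk; rewrite klN => /(_ p (ltn_ord p)).
  rewrite -/t; lia.
rewrite /d -[t.+1]addn1 natrD; lra.
Qed.

Lemma sum_sqr_flip (N : nat) (f : core u v + 'I_N.+1 -> R) :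
  \sum_s flip_spine f s ^+ 2 = \sum_s f s ^+ 2.
Proof.
by rewrite !big_sumType; congr (_ + _); rewrite [RHS](reindex_inj rev_ord_inj).
Qed.

End SpineForm.

(** * Comparison of the largest eigenvalues and the equality case *)

Theorem theorem5p8 (R : realType) (n k l : nat) (V : finType) (e : rel V)
    (u1 v1 : V)
    (l_ge2 : (2 <= l)%N) (k_gel : (l <= k)%N) (n_gt : (k + l < n)%N)
    (cardV : #|V| = (n - k - l + 2)%N)
    (e_simple : simple_graph e) (e_conn : connected_graph e)
    (uv_adj : e u1 v1)
    (uv_twins : neighbours e u1 :\ v1 = neighbours e v1 :\ u1) :
  dL1 R (two_paths e u1 v1 k.+1 l.-1) >= dL1 R (two_paths e u1 v1 k l)
  /\ (dL1 R (two_paths e u1 v1 k.+1 l.-1) = dL1 R (two_paths e u1 v1 k l) ->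
      exists x : 'cV[R]_#|{: (V + 'I_k.-1) + 'I_l.-1}|,
        [/\ dist_laplacian R (two_paths e u1 v1 k l) *m x
              = dL1 R (two_paths e u1 v1 k l) *: x,
            \sum_i x i 0 ^+ 2 = 1
          & forall w w' : V,
              x (enum_rank (inl (inl w))) 0 = x (enum_rank (inl (inl w'))) 0]).
Proof.
have [e_sym e_irr] := e_simple.
have uv_neq : u1 != v1 by apply: contraTneq uv_adj => ->; rewrite e_irr.
have [N klN] : exists N, (k + l = N.+1)%N by exists (k + l).-1; lia.
have [k_gt0 l_gt0 l1_gt0] : [/\ 0 < k, 0 < l & 0 < l.-1]%N by split; lia.
have klN' : (k.+1 + l.-1 = N.+1)%N by lia.
have G_sym a b := @two_paths_sym V e u1 v1 e_sym a b.
have G_conn a b := @two_paths_connected V e u1 v1 e_conn a b.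
have c_bij a b :=
  @spine_coord_bij V e u1 v1 e_sym e_conn uv_adj uv_neq uv_twins N a b.
have c_dist a b :=
  @gdist_two_paths V e u1 v1 e_sym e_conn uv_adj uv_neq uv_twins N a b.
set G := two_paths e u1 v1 k l; set G' := two_paths e u1 v1 k.+1 l.-1.
have [g g_eigen [g_unit g_form]] : exists2 f : (V + 'I_k.-1) + 'I_l.-1 -> R,
    let x := \col_i f (enum_val i) in dist_laplacian R G *m x = dL1 R G *: x &
    \sum_p f p ^+ 2 = 1 /\ dist_form (gdist G) f = 2 * dL1 R G.
  apply: dL1_eigenvector; [exact: G_sym|exact: G_conn|].
  by apply/card_gt0P; exists (inl (inl u1)).
have [ci cK ciK] := c_bij k l k_gt0 l_gt0 klN.
pose f := g \o ci.
have f_form : dist_form (spine_dist e k) f = 2 * dL1 R G.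
  rewrite (dist_form_bij _ _ (c_bij k l k_gt0 l_gt0 klN)) -g_form.
  apply: eq_bigr => p _; apply: eq_bigr => q _.
  by rewrite /f /= !cK c_dist.
have f_unit : \sum_s f s ^+ 2 = 1.
  rewrite (reindex _ (onW_bij _ (c_bij k l k_gt0 l_gt0 klN))) -g_unit.
  by apply: eq_bigr => p _; rewrite /f /= cK.
(* Every unit function on the common coordinates is a trial vector for [G']; this is applied to [f]
   and to its flip. *)
have G'_bound (h : core u1 v1 + 'I_N.+1 -> R) :
    \sum_s h s ^+ 2 = 1 -> dist_form (spine_dist e k.+1) h <= 2 * dL1 R G'.
  have c'_bij := c_bij _ _ (ltn0Sn k) l1_gt0 klN'.
  move=> h_unit; rewrite (dist_form_bij _ _ c'_bij).
  have := dist_form_le_dL1 (G_sym k.+1 l.-1) (G_conn k.+1 l.-1)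
    (h \o @spine_coord V u1 v1 N k.+1 l.-1).
  have -> : \sum_p (h \o @spine_coord V u1 v1 N k.+1 l.-1) p ^+ 2 = 1.
    by rewrite -h_unit [RHS](reindex _ (onW_bij _ c'_bij)).
  rewrite mulr1; apply: le_trans; rewrite le_eqVlt; apply/orP; left; apply/eqP.
  by apply: eq_bigr => p _; apply: eq_bigr => q _; rewrite c_dist.
have := spine_form_shift e f l_gt0 k_gel klN.
have := G'_bound _ f_unit.
have := G'_bound (flip_spine f); rewrite sum_sqr_flip => /(_ f_unit).
set X := cross_form _ _; set t := (k.+1 - l)%N.
rewrite f_form.
set Q1 := dist_form _ (flip_spine f); set Q2 := dist_form _ f => Q1_le Q2_le.
have t_ge0 : 0 <= t%:R :> R by rewrite ler0n.
have tQ2 : t%:R * Q2 <= t%:R * (2 * dL1 R G') by rewrite ler_wpM2l.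
rewrite -[t.+1]addn1 natrD => shift.
have X_ge0 : 0 <= X.
  by do 2![apply: sumr_ge0 => ? _]; rewrite mulr_ge0 ?sqr_ge0.
(* The shift inequality with [Q1] and [Q2] both replaced by their bound [2 * dL1 R G']. As [X] is
   nonnegative, the inequality of the theorem follows, and equality forces [X = 0]. *)
have tX : X <= (t%:R + 1) * (dL1 R G' - dL1 R G) by lra.
split.
  have : 0 <= (t%:R + 1) * (dL1 R G' - dL1 R G) by apply: le_trans tX.
  by rewrite pmulr_rge0 ?ltr_wpDl // subr_ge0.
move=> GG'; exists (\col_i g (enum_val i)); split => //.
  rewrite -g_unit [RHS](reindex _ (onW_bij _ (enum_val_bij _))) /=.
  by apply: eq_bigr => i _; rewrite mxE.
have X0 : X = 0.
  by apply/eqP; rewrite eq_le X_ge0 andbT (le_trans tX) // GG' subrr mulr0.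
(* All terms of [X] are nonnegative, so each vanishes; positions [k.-1] and [k] are those of [u1]
   and [v1]. *)
have f_spine (w : core u1 v1) (p : 'I_N.+1) :
    (p == k.-1 :> nat) || (p == k :> nat) -> f (inr p) = f (inl w).
  move=> pk; move: X0 => /psumr_eq0P/(_ w isT) => X0.
  have {}X0 := X0 (fun _ _ =>
    sumr_ge0 _ (fun _ _ => mulr_ge0 (ler0n _ _) (sqr_ge0 _))).
  have /(_ _ p isT) := psumr_eq0P _ X0.
  rewrite pk mul1r => /(_ (fun _ _ => mulr_ge0 (ler0n _ _) (sqr_ge0 _))) /eqP.
  by rewrite sqrf_eq0 subr_eq0 => /eqP.
(* By [k + l < n] there is a core vertex; it links the values at [u1] and [v1], which [f_spine]
   relates only through the core. *)
have core_inhab : exists w0 : V, (w0 != u1) && (w0 != v1).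
  have : (0 < #|~: [set u1; v1]|)%N.
    by have := cardsC [set u1; v1]; rewrite cards2 uv_neq cardV; lia.
  by case/card_gt0P => w0; rewrite !inE negb_or; exists w0.
have [w0 w0P] := core_inhab.
(* The value at [v1], numbered [k], serves as the common constant. *)
suff g_const w : g (inl (inl w)) = f (inr (inord k)).
  by move=> w w'; rewrite !mxE !enum_rankK !g_const.
rewrite -[inl (inl w)]cK -[LHS]/(f _).
have f_k := f_spine _ (inord k); have f_k1 := f_spine _ (inord k.-1).
rewrite inordK ?eqxx ?orbT in f_k; last lia.
rewrite inordK ?eqxx in f_k1; last lia.
case: (coreP u1 v1 N k l w) => [_|_|w' _ _ _] //.
  by rewrite (f_k1 (exist _ w0 w0P)) // -f_k.
by rewrite -f_k.
Qed.
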